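(* For every integer $n>0$ there exists a bijection $\phi_3:\pi_{ped}(n)\to \pi_{DE3}(n+2)\cup\pi_{DE3}(n-1)$. In particular, $\mathrm{DE3}(n+2)+\mathrm{DE3}(n-1)=\mathrm{ped}(n)$; that is, $\mathrm{DE3}(n+2)+\mathrm{DE3}(n-1)$ equals the number of $4$-regular partitions of $n$.
   Context: A partition of a positive integer $n$ is a finite non-increasing sequence $\lambda=(\lambda_1,\ldots,\lambda_k)$ of positive integers with $\sum_{i=1}^k\lambda_i=n$. $\pi_{ped}(n)$ is the set of partitions of $n$ in which no even part is repeated (odd parts may repeat), and $\mathrm{ped}(n)=|\pi_{ped}(n)|$. $\pi_{DE3}(n)$ is the set of partitions of $n$ in which no even part is repeated and the largest part is odd and appears exactly once, and $\mathrm{DE3}(n)=|\pi_{DE3}(n)|$; equivalently $\sum_{n\ge 0}\mathrm{DE3}(n)q^n=\sum_{n\ge0}\frac{(-q^2;q^2)_n q^{2n+1}}{(q;q^2)_{n}}$, where $(a;q)_n=\prod_{j=0}^{n-1}(1-aq^j)$. In particular $\pi_{DE3}(0)=\emptyset$ and $\mathrm{DE3}(0)=0$. The sets $\pi_{DE3}(n+2)$ and $\pi_{DE3}(n-1)$ consist of partitions of different integers, so their union is disjoint. A $4$-regular partition is a partition none of whose parts is divisible by $4$. *)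

(* Defs.v *)
From mathcomp Require Import all_boot finmap.

Set Implicit Arguments.
Unset Strict Implicit.
Unset Printing Implicit Defensive.

Local Open Scope fset_scope.

Definition is_partition (n : nat) (s : seq nat) : bool :=
  [&& sorted geq s, all (fun x => 0 < x) s & sumn s == n].

(* A partition of n has at most n parts, each at most n: the sequences with
   these bounds form a finite type, which provides the ambient finite set.
   Lemma in_partitions shows that the bounds lose nothing. *)
Definition partitions (n : nat) : {fset seq nat} :=
  [fset s in [seq map val (bseqval t) | t : n.-bseq 'I_n.+1] | is_partition n s].

Lemma in_partitions (n : nat) (s : seq nat) :
  (s \in partitions n) = is_partition n s.
Proof.
rewrite !inE /=; apply/andP/idP => [[]//|Hs]; split=> //.
have /and3P[_ s_gt0 /eqP s_sum] := Hs.
have s_le x : x \in s -> x < n.+1.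
  move=> xs; rewrite ltnS -s_sum.
  by rewrite (perm_sumn (perm_to_rem xs)) /= leq_addr.
have s_size : size s <= n.
  rewrite -s_sum; elim: s s_gt0 {Hs s_sum s_le} => //= x s IHs /andP[x0 /IHs].
  by move=> le_s; rewrite -add1n leq_add.
have t_size : size (map (@inord n) s) <= n by rewrite size_map.
apply/imageP; exists (Bseq t_size) => //=.
rewrite -map_comp map_id_in // => x /s_le xn /=.
by rewrite inordK.
Qed.

Definition no_repeated_even (s : seq nat) : bool :=
  all (fun x => ~~ odd x ==> (count_mem x s == 1)) s.

(* Parts are non-increasing, so the head is the largest part; the default value
   0 is even, so the empty partition is excluded. *)
Definition largest_odd_once (s : seq nat) : bool :=
  odd (head 0 s) && (count_mem (head 0 s) s == 1).

Definition pi_ped (n : nat) : {fset seq nat} :=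
  [fset s in partitions n | no_repeated_even s].

Definition pi_DE3 (n : nat) : {fset seq nat} :=
  [fset s in partitions n | no_repeated_even s && largest_odd_once s].

Definition pi_4reg (n : nat) : {fset seq nat} :=
  [fset s in partitions n | all (fun x => ~~ (4 %| x)) s].

Definition ped (n : nat) : nat := #|` pi_ped n|.

Definition DE3 (n : nat) : nat := #|` pi_DE3 n|.

(* Main.v *)
(* Write the largest part of [s] in pi_ped(n) as [x].  If [x] is odd, replace it
   by [x + 2]; if [x] is even and [x - 1] is a part, replace the pair
   [(x, x - 1)] by [(x + 1, x)]; otherwise replace [x] by [x - 1].  The first two
   cases together reach every element of pi_DE3(n + 2) exactly once, according
   to whether the second part is one less than the largest, and the third case
   reaches every element of pi_DE3(n - 1) exactly once.
   For 4-regular partitions, a part [2 ^ j * c] with [c] congruent to 2 mod 4 is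
   split into [2 ^ j] copies of [c]; since even parts are distinct, uniqueness of
   binary expansions makes this reversible. *)
Require Import Defs.
From mathcomp Require Import all_boot finmap zify.

(** * Bijections between finite sets *)

Lemma fset_bijective (K L : choiceType) (A : {fset K}) (B : {fset L})
    (f : K -> L) (g : L -> K) :
  (forall x, x \in A -> f x \in B) -> (forall y, y \in B -> g y \in A) ->
  {in A, cancel f g} -> {in B, cancel g f} ->
  exists phi : A -> B, bijective phi.
Proof.
move=> fAB gBA fK gK.
exists (fun x : A => [` fAB _ (valP x)]%fset).
exists (fun y : B => [` gBA _ (valP y)]%fset) => [x|y]; apply/val_inj => /=.
  by rewrite fK ?valP.
by rewrite gK ?valP.
Qed.

Lemma card_fset_bijective (K L : choiceType) (A : {fset K}) (B : {fset L})
    (phi : A -> B) :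
  bijective phi -> #|` A|%fset = #|` B|%fset.
Proof. by move=> /bij_eq_card; rewrite !cardfE. Qed.

(** * Partitions with distinct even parts as sorted sequences *)

(** Strictness exactly after an even part merges the order and the distinctness of even parts into
    one local condition on neighbours. *)
Definition ped_rel (x y : nat) : bool := if odd x then y <= x else y < x.

Lemma ped_rel_trans : transitive ped_rel.
Proof. by move=> y x z; rewrite /ped_rel; do 2?case: ifP; lia. Qed.

Lemma geq_trans : transitive geq.
Proof. by move=> y x z /= yx zy; apply: leq_trans zy yx. Qed.

(** Both relations are transitive, so sortedness compares the head with every later part; an even
    head occurs once exactly when all later parts are strictly smaller. *)
Lemma sorted_ped_rel s : sorted geq s && no_repeated_even s = sorted ped_rel s.
Proof.
elim: s => // x t IHt.
rewrite /sorted !path_sortedE; [|exact: ped_rel_trans|exact: geq_trans].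
rewrite -IHt -/(sorted geq t); case: (sorted geq t); rewrite ?andbF //= !andbT.
apply/idP/idP.
  move=> /and3P[le_t x1 /allP t1]; apply/andP; split; apply/allP => y yt.
    move: (allP le_t y yt); rewrite /ped_rel /= leq_eqVlt; case: ifP => [|ox].
      by rewrite leq_eqVlt.
    case/orP=> // /eqP yx; subst y; move: x1; rewrite ox /= eqxx.
    by rewrite add1n eqSS -leqn0 leqNgt -has_count has_pred1 yt.
  move: (t1 y yt); case: (odd y) => //=.
  have: 0 < count_mem y t by rewrite -has_count has_pred1.
  by case: (count _ _) => // k _; case: (x == y) => //=; rewrite addnS.
move=> /andP[r_t /allP t1].
have xt : ~~ odd x -> x \notin t.
  move=> ox; apply/negP => /(allP r_t); rewrite /ped_rel (negPf ox).
  by rewrite ltnn.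
apply/and3P; split.
- by apply/allP=> y /(allP r_t); rewrite /ped_rel /=; case: ifP => // _ /ltnW.
- by apply/implyP => /xt /count_memPn /= ->; rewrite eqxx.
apply/allP=> y yt; apply/implyP=> oy; move: (t1 y yt); rewrite oy /=.
by case: (x =P y) => // xy; move: (xt); rewrite xy yt => /(_ oy).
Qed.

Lemma pi_pedE n s : (s \in pi_ped n) = is_partition n s && no_repeated_even s.
Proof. by rewrite in_fset inE -in_partitions. Qed.

Lemma pi_4regE n s :
  (s \in pi_4reg n) = is_partition n s && all (fun x => ~~ (4 %| x)) s.
Proof. by rewrite in_fset inE -in_partitions. Qed.

Lemma in_pi_ped n s :
  (s \in pi_ped n) = [&& sorted ped_rel s, all (fun x => 0 < x) s & sumn s == n].
Proof.
rewrite pi_pedE /is_partition -sorted_ped_rel.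
by case: (sorted geq s); case: no_repeated_even; rewrite ?andbF ?andbT.
Qed.

(** In a non-increasing sequence a repeated largest part would also be the second entry. For a
    single part the default [0] makes the last condition true, an odd number being positive. *)
Lemma in_pi_DE3 n s :
  (s \in pi_DE3 n) =
  [&& s \in pi_ped n, odd (head 0 s) & head 0 (behead s) < head 0 s].
Proof.
have -> : (s \in pi_DE3 n) = (s \in partitions n) &&
    (no_repeated_even s && largest_odd_once s) by rewrite in_fset inE.
rewrite pi_pedE -in_partitions -!andbA; case: (boolP (s \in partitions n)) => //=.
rewrite in_partitions; case: no_repeated_even => //= /andP[s_sorted _].
rewrite /largest_odd_once; case: (boolP (odd (head 0 s))) => //=.
case: s s_sorted => //= x t; rewrite eqxx add1n eqSS => xt ox.
apply/idP/idP.
  rewrite -leqn0 leqNgt -has_count has_pred1.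
  case: t xt => [|y t] /=; first by case: x ox.
  by rewrite leq_eqVlt inE eq_sym => /andP[/orP[->|//] _].
move=> ltx; apply/eqP/count_memPn/negP => xt'.
case: t xt ltx xt' => //= y t /andP[_]; rewrite path_sortedE; last exact: geq_trans.
move=> /andP[/allP yt _] lt_yx; rewrite inE => /orP[/eqP xy|/yt /=].
  by rewrite xy ltnn in lt_yx.
by rewrite leqNgt lt_yx.
Qed.

(** * The bijection onto the disjoint union *)

Definition ped_to_DE3 (s : seq nat) : seq nat :=
  if s is x :: t then
    if odd x then x.+2 :: t
    else if head 0 t == x.-1 then x.+1 :: x :: behead t else x.-1 :: t
  else [::].

(** The sum tells which of the two sets [s] comes from. In the case [n + 2], a single part is at
    least [3], so the default [0] is never mistaken for a second part [x.-1]. *)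
Definition DE3_to_ped (n : nat) (s : seq nat) : seq nat :=
  if s is x :: t then
    if sumn s == n - 1 then x.+1 :: t
    else if head 0 t == x.-1 then x.-1 :: x.-2 :: behead t else x.-2 :: t
  else [::].

Lemma ped_to_DE3_in n s : 0 < n -> s \in pi_ped n ->
  ped_to_DE3 s \in (pi_DE3 (n + 2) `|` pi_DE3 (n - 1))%fset.
Proof.
move=> n_gt0; rewrite in_fsetU !in_pi_DE3 !in_pi_ped.
case: s => [|x [|y [|z t]]] /=.
- by lia.
- by rewrite /ped_rel; do ?case: ifP => /=; lia.
- by rewrite /ped_rel; do ?case: ifP => /=; lia.
(* Only the first two parts change, so the conditions beyond the third part stay opaque and the rest
   is linear arithmetic. *)
do ?case: ifP => /=; move: (path _ z t) (all _ t) (sumn t) => p a m;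
  by rewrite /ped_rel; do ?case: ifP => /=; lia.
Qed.

Lemma DE3_to_ped_in n s : 0 < n ->
  s \in (pi_DE3 (n + 2) `|` pi_DE3 (n - 1))%fset -> DE3_to_ped n s \in pi_ped n.
Proof.
move=> n_gt0; rewrite in_fsetU !in_pi_DE3 !in_pi_ped.
case: s => [|x [|y [|z t]]] /=.
- by lia.
- by rewrite /ped_rel; do ?case: ifP => /=; lia.
- by rewrite /ped_rel; do ?case: ifP => /=; lia.
do ?case: ifP => /=; move: (path _ z t) (all _ t) (sumn t) => p a m;
  by rewrite /ped_rel; do ?case: ifP => /=; lia.
Qed.

Lemma ped_to_DE3K n : 0 < n -> {in pi_ped n, cancel ped_to_DE3 (DE3_to_ped n)}.
Proof.
move=> n_gt0 s; rewrite in_pi_ped.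
case: s => [|x [|y t]] //=.
- rewrite /ped_rel; (do ?case: ifP => /=) => *; try lia; congr [:: _]; lia.
move: (path _ y t) (all _ t) => p a.
rewrite /ped_rel; (do ?case: ifP => /=) => *; try lia; congr [:: _, _ & t]; lia.
Qed.

Lemma DE3_to_pedK n : 0 < n ->
  {in (pi_DE3 (n + 2) `|` pi_DE3 (n - 1))%fset,
    cancel (DE3_to_ped n) ped_to_DE3}.
Proof.
move=> n_gt0 s; rewrite in_fsetU !in_pi_DE3 !in_pi_ped.
case: s => [|x [|y t]] //=.
- rewrite /ped_rel; (do ?case: ifP => /=) => *; try lia; congr [:: _]; lia.
move: (path _ y t) (all _ t) => p a.
rewrite /ped_rel; (do ?case: ifP => /=) => *; try lia; congr [:: _, _ & t]; lia.
Qed.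

(** * Binary expansions *)

Lemma divn_exp2S m j : m %/ 2 ^ j.+1 = m./2 %/ 2 ^ j.
Proof. by rewrite expnS divnMA divn2. Qed.

Lemma sum_binary_digits N m :
  m < 2 ^ N -> \sum_(j < N) 2 ^ j * odd (m %/ 2 ^ j) = m.
Proof.
elim: N m => [|N IHN] m; first by rewrite expn0 big_ord0; case: m.
rewrite expnS => m_lt; rewrite big_ord_recl expn0 mul1n divn1.
under eq_bigr => j _ do
  rewrite lift0 divn_exp2S expnS -mulnA.
rewrite -big_distrr /= IHN; last by lia.
by rewrite mul2n odd_double_half.
Qed.

(** Uniqueness of the expansion: halving removes the lowest digit and shifts [b]. With
    [sum_binary_digits], which gives existence, it makes splitting reversible. *)
Lemma binary_digit_sum N (b : nat -> bool) i : i < N ->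
  odd ((\sum_(j < N) 2 ^ j * b j) %/ 2 ^ i) = b i.
Proof.
elim: N b i => // N IHN b i iN; rewrite big_ord_recl expn0 mul1n.
under eq_bigr => j _ do rewrite lift0 expnS -mulnA.
rewrite -big_distrr /= mul2n; case: i iN => [|i] iN.
  by rewrite expn0 divn1 oddD odd_double addbF oddb.
by rewrite divn_exp2S half_bit_double (IHN (b \o S)).
Qed.

(** * Multiplicities and sums *)

Lemma count_flatten_nseq (T : Type) (f g : T -> nat) (s : seq T) c :
  count_mem c (flatten [seq nseq (f x) (g x) | x <- s]) =
  \sum_(x <- s) f x * (g x == c).
Proof.
elim: s => [|x s IHs]; first by rewrite big_nil.
by rewrite big_cons /= count_cat count_nseq IHs mulnC.
Qed.

Lemma sumn_flatten_nseq (T : Type) (f g : T -> nat) (s : seq T) :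
  sumn (flatten [seq nseq (f x) (g x) | x <- s]) = \sum_(x <- s) f x * g x.
Proof.
elim: s => [|x s IHs]; first by rewrite big_nil.
by rewrite big_cons /= sumn_cat sumn_nseq IHs mulnC.
Qed.

Lemma count_mem_mul_leq c s : count_mem c s * c <= sumn s.
Proof.
elim: s => //= x s IHs; rewrite mulnDl leq_add //.
by case: eqP => [->|_]; rewrite ?mul1n ?mul0n.
Qed.

Lemma mem_leq_sumn x s : x \in s -> x <= sumn s.
Proof.
rewrite -has_pred1 has_count => x_s.
by apply: leq_trans (count_mem_mul_leq x s); rewrite leq_pmull.
Qed.

Lemma sorted_geq_inj s t : sorted geq s -> sorted geq t ->
  (forall x, count_mem x s = count_mem x t) -> s = t.
Proof.
move=> s_sorted t_sorted eq_st; apply: (sorted_eq geq_trans) => //.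
  by move=> x y /=; lia.
by apply/allP => x _; rewrite /= eq_st.
Qed.

(** * Powers of two inside a part *)

(* At odd [x] the truncated predecessor makes the exponent [0], so that odd
   parts are left alone. *)
Definition twoexp (x : nat) : nat := (logn 2 x).-1.

(** For even positive [x] this is twice the odd part of [x], hence congruent to 2 modulo 4. *)
Definition core (x : nat) : nat := x %/ 2 ^ twoexp x.

Lemma twoexp_odd x : odd x -> twoexp x = 0.
Proof. by rewrite /twoexp lognE => ox; rewrite dvdn2 ox !andbF. Qed.

Lemma core_odd x : odd x -> core x = x.
Proof. by move=> ox; rewrite /core twoexp_odd // divn1. Qed.

Lemma mul_twoexp_core x : 2 ^ twoexp x * core x = x.
Proof.
rewrite mulnC divnK //; case: (posnP x) => [->|x_gt0]; first by rewrite dvdn0.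
by rewrite pfactor_dvdn // /twoexp leq_pred.
Qed.

Lemma core_gt0 x : 0 < x -> 0 < core x.
Proof. by rewrite -{1}(mul_twoexp_core x) muln_gt0 => /andP[]. Qed.

Lemma logn_core x : 0 < x -> logn 2 (core x) = ~~ odd x.
Proof.
move=> x_gt0; have := congr1 (logn 2) (mul_twoexp_core x).
rewrite lognM ?expn_gt0 ?core_gt0 // lognX logn_prime // eqxx muln1 /twoexp.
have : (0 < logn 2 x) = ~~ odd x by rewrite logn_gt0 mem_primes x_gt0 dvdn2.
by case: odd => /=; lia.
Qed.

(** Here [logn 2 c = 1] encodes that [c] is congruent to 2 modulo 4; the factorization of an even
    number as [2 ^ j * c] with such a [c] is unique. *)
Lemma core_mul2X j c : logn 2 c = 1 ->
  twoexp (2 ^ j * c) = j /\ core (2 ^ j * c) = c.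
Proof.
move=> c1; have c_gt0 : 0 < c by case: c c1.
have e_j : twoexp (2 ^ j * c) = j.
  by rewrite /twoexp lognM ?expn_gt0 // lognX logn_prime // eqxx c1 muln1 addn1.
by rewrite /core e_j mulKn ?expn_gt0.
Qed.

Lemma core_ndvd4 x : 0 < x -> ~~ (4 %| core x).
Proof.
move=> x_gt0; rewrite (@pfactor_dvdn 2 2) ?core_gt0 // logn_core //.
by case: odd.
Qed.

(** * Splitting and merging parts *)

Definition split_parts (s : seq nat) : seq nat :=
  sort geq (flatten [seq nseq (2 ^ twoexp x) (core x) | x <- s]).

(** An even part [2 ^ j * c] is present exactly when the binary digit [j] of the multiplicity of [c]
    is 1. *)
Definition merged_mult (t : seq nat) (x : nat) : nat :=
  if odd x then count_mem x t else odd (count_mem (core x) t %/ 2 ^ twoexp x).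

Definition merge_parts (n : nat) (t : seq nat) : seq nat :=
  sort geq (flatten [seq nseq (merged_mult t x) x | x <- iota 1 n]).

Lemma sorted_sort_geq s : sorted geq (sort geq s).
Proof. by apply: sort_sorted => x y /=; lia. Qed.

Lemma count_sort_geq s x : count_mem x (sort geq s) = count_mem x s.
Proof. by apply/permP; rewrite perm_sort. Qed.

Lemma sumn_split_parts s : sumn (split_parts s) = sumn s.
Proof.
rewrite /split_parts (@perm_sumn _ _ (permEl (perm_sort _ _))).
rewrite sumn_flatten_nseq sumnE.
by apply: eq_bigr => x _; rewrite mul_twoexp_core.
Qed.

Lemma mem_split_parts s c : c \in split_parts s -> exists2 x, x \in s & c = core x.
Proof.
rewrite mem_sort => /flatten_mapP[x xs]; rewrite mem_nseq => /andP[_ /eqP ->].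
by exists x.
Qed.

(** Odd parts are kept, and an even part has an even core, so it yields no copy of [c]. *)
Lemma count_split_parts_odd s c : all (leq 1) s -> odd c ->
  count_mem c (split_parts s) = count_mem c s.
Proof.
move=> /allP s_gt0 oc; rewrite count_sort_geq count_flatten_nseq.
rewrite -sum1_count [RHS]big_mkcond /= [LHS]big_seq [RHS]big_seq.
apply: eq_bigr => x /s_gt0 x_gt0; case: (boolP (odd x)) => ox.
  by rewrite core_odd // twoexp_odd // mul1n; case: eqP.
have := logn_core x x_gt0; rewrite ox.
case: eqP => [->|_]; first by rewrite lognE dvdn2 oc !andbF.
by rewrite muln0; case: eqP ox => // ->; rewrite oc.
Qed.

Lemma count_split_parts_even n s c : all (fun x => 0 < x <= n) s ->
  logn 2 c = 1 ->
  count_mem c (split_parts s) = \sum_(j < n) 2 ^ j * count_mem (2 ^ j * c) s.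
Proof.
move=> /allP s_n c1; rewrite count_sort_geq count_flatten_nseq.
under [RHS]eq_bigr => j _ do rewrite -sum1_count big_mkcond big_distrr /=.
(* After swapping the sums, each part [x] is treated alone: it contributes only if its core is [c],
   and then only at [j = twoexp x]. *)
rewrite exchange_big /= [LHS]big_seq [RHS]big_seq; apply: eq_bigr => x xs.
have /andP[x_gt0 x_len] := s_n x xs.
case: eqP => [cx|ncx]; last first.
  rewrite muln0 big1 // => j _; case: eqP => [xj|_]; last by rewrite muln0.
  by case: ncx; rewrite xj; case: (core_mul2X j c c1).
(* The range [j < n] suffices, since [twoexp x < 2 ^ twoexp x <= x <= n]. *)
have lt_en : twoexp x < n.
  apply: leq_trans x_len; rewrite -{2}(mul_twoexp_core x).
  by apply: (leq_trans (ltn_expl _ (ltnSn 1))); rewrite leq_pmulr ?core_gt0.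
rewrite (bigD1 (Ordinal lt_en)) //= -cx mul_twoexp_core eqxx big1 ?addn0 // => j ne_j.
case: eqP => [xj|_]; last by rewrite muln0.
case/eqP: ne_j; apply: val_inj => /=; rewrite [in RHS]xj cx.
by case: (core_mul2X j c c1) => ->.
Qed.

Lemma count_merge_parts n t x :
  count_mem x (merge_parts n t) = (0 < x <= n) * merged_mult t x.
Proof.
rewrite count_sort_geq count_flatten_nseq.
case: (boolP (0 < x <= n)) => x_n.
  rewrite (bigD1_seq x) ?iota_uniq ?mem_iota ?add1n ?ltnS //= eqxx muln1 mul1n.
  by rewrite big1 ?addn0 // => y /negPf ->; rewrite muln0.
rewrite mul0n big_seq big1 // => y; rewrite mem_iota add1n ltnS => y_n.
by case: eqP => [yx|_]; rewrite ?muln0 // -yx y_n in x_n *.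
Qed.

Lemma split_partsK n : {in pi_ped n, cancel split_parts (merge_parts n)}.
Proof.
move=> s; rewrite pi_pedE => /andP[/and3P[s_sorted s_gt0 /eqP s_sum] /allP s_even].
apply: sorted_geq_inj => // [|x]; first exact: sorted_sort_geq.
rewrite count_merge_parts; case: (boolP (0 < x <= n)) => [/andP[x_gt0 x_n]|x_n]; last first.
  rewrite mul0n; apply/esym/count_memPn/negP => xs; case/negP: x_n.
  by rewrite (allP s_gt0) //= -s_sum mem_leq_sumn.
rewrite mul1n /merged_mult; case: ifP => ox; first exact: count_split_parts_odd.
rewrite (count_split_parts_even n) ?logn_core ?ox //; last first.
  by apply/allP => y ys; rewrite (allP s_gt0) //= -s_sum mem_leq_sumn.
(* Even parts do not repeat, so their multiplicities are binary digits. *)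
have count_s j : count_mem (2 ^ j * core x) s = (2 ^ j * core x \in s).
  case: (boolP (_ \in s)) => [js|/count_memPn //].
  have := s_even _ js; rewrite oddM.
  have := logn_core x x_gt0; rewrite ox.
  case: (boolP (odd (core x))) => [|_ _]; first by rewrite lognE dvdn2 => ->; rewrite !andbF.
  by rewrite andbF => /eqP.
under eq_bigr => j _ do rewrite count_s.
rewrite (binary_digit_sum _ (fun j => 2 ^ j * core x \in s)).
  by rewrite -count_s mul_twoexp_core.
apply: leq_trans x_n; rewrite -{2}(mul_twoexp_core x).
by apply: (leq_trans (ltn_expl _ (ltnSn 1))); rewrite leq_pmulr ?core_gt0.
Qed.

Lemma merge_parts_range n t : all (fun x => 0 < x <= n) (merge_parts n t).
Proof.
apply/allP => x; rewrite mem_sort => /flatten_mapP[y].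
by rewrite mem_iota mem_nseq add1n ltnS => y_n /andP[_ /eqP ->].
Qed.

Lemma merge_parts_gt0 n t : all (leq 1) (merge_parts n t).
Proof. by apply: sub_all (merge_parts_range n t) => x /andP[]. Qed.

(** Multiplicities of [c] are compared for [c] zero, odd, divisible by 4, and congruent to 2 modulo
    4; only the last case uses binary expansions. *)
Lemma merge_partsK n : {in pi_4reg n, cancel (merge_parts n) split_parts}.
Proof.
move=> t; rewrite pi_4regE => /andP[/and3P[t_sorted t_gt0 /eqP t_sum] /allP t_reg].
apply: sorted_geq_inj => // [|c]; first exact: sorted_sort_geq.
have [->|c_gt0] := posnP c.
  rewrite !(count_memPn _) //; apply/negP.
    by move/(allP t_gt0).
  case/mem_split_parts => x /(allP (merge_parts_gt0 n t)) /= x_gt0 cx.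
  by have := core_gt0 x x_gt0; rewrite -cx.
case: (boolP (odd c)) => oc.
  rewrite count_split_parts_odd ?merge_parts_gt0 // count_merge_parts.
  rewrite /merged_mult oc c_gt0 /=; case: leqP => [_|c_n]; first exact: mul1n.
  apply/esym/count_memPn/negP => /mem_leq_sumn.
  by rewrite t_sum leqNgt c_n.
case: (boolP (4 %| c)) => c4.
  rewrite !(count_memPn _) //; apply/negP.
    by move/t_reg; rewrite c4.
  case/mem_split_parts => x /(allP (merge_parts_gt0 n t)) /= x_gt0 cx.
  by have := core_ndvd4 x x_gt0; rewrite -cx c4.
have c1 : logn 2 c = 1.
  apply/eqP; rewrite eqn_leq -ltnS ltnNge -!pfactor_dvdn // c4 /=.
  by rewrite expn1 dvdn2.
rewrite (count_split_parts_even n) ?merge_parts_range //.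
(* The multiplicity of [c] is at most [n < 2 ^ n], so [n] digits are enough. *)
rewrite -[RHS](sum_binary_digits n); last first.
  apply: leq_ltn_trans (ltn_expl n (ltnSn 1)); rewrite -t_sum.
  by apply: leq_trans (count_mem_mul_leq c t); rewrite leq_pmulr.
apply: eq_bigr => j _; congr (_ * _).
have [e_j core_j] := core_mul2X j c c1.
have jc_even : odd (2 ^ j * c) = false by rewrite oddM (negPf oc) andbF.
rewrite count_merge_parts /merged_mult jc_even e_j core_j.
rewrite muln_gt0 expn_gt0 c_gt0 /=; case: leqP => [_|lt_n]; first exact: mul1n.
(* A part [2 ^ j * c] above [n] is never listed by [merge_parts]; its digit is 0 as well, because
   the copies of [c] in [t] sum to at most [n]. *)
rewrite divn_small // -(ltn_pmul2r c_gt0).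
by apply: leq_ltn_trans lt_n; rewrite -t_sum count_mem_mul_leq.
Qed.

Lemma split_parts_in n s : s \in pi_ped n -> split_parts s \in pi_4reg n.
Proof.
rewrite pi_pedE pi_4regE /is_partition => /andP[/and3P[_ /allP s_gt0 s_sum] _].
rewrite sorted_sort_geq sumn_split_parts s_sum /= andbT.
apply/andP; split; apply/allP => x /mem_split_parts[y /s_gt0 y_gt0 ->].
  exact: core_gt0.
exact: core_ndvd4.
Qed.

Lemma merge_parts_in n t : t \in pi_4reg n -> merge_parts n t \in pi_ped n.
Proof.
move=> t_reg; have := t_reg; rewrite pi_pedE pi_4regE /is_partition.
move=> /andP[/and3P[_ _ t_sum] _].
(* Splitting preserves the sum and sends the merged sequence back to [t], so merging preserves the
   sum too. *)
rewrite sorted_sort_geq merge_parts_gt0 -sumn_split_parts merge_partsK // t_sum /=.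
apply/allP => x x_in; apply/implyP => /negPf ox; rewrite count_merge_parts.
have := x_in; rewrite -has_pred1 has_count count_merge_parts /merged_mult ox.
by rewrite muln_gt0 => /andP[]; case: (0 < x <= n); case: (odd _).
Qed.

Theorem lemma2p5 (n : nat) (n_gt0 : 0 < n) :
  (exists phi3 : pi_ped n -> (pi_DE3 (n + 2) `|` pi_DE3 (n - 1))%fset,
     bijective phi3)
  /\ DE3 (n + 2) + DE3 (n - 1) = ped n
  /\ DE3 (n + 2) + DE3 (n - 1) = #|` pi_4reg n|%fset.
Proof.
have ex_phi : exists phi3 : pi_ped n -> (pi_DE3 (n + 2) `|` pi_DE3 (n - 1))%fset,
    bijective phi3.
  apply: (fset_bijective _ _ _ _ ped_to_DE3 (DE3_to_ped n)) => [s|s||].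
  - exact: ped_to_DE3_in.
  - exact: DE3_to_ped_in.
  - exact: ped_to_DE3K.
  - exact: DE3_to_pedK.
have card_ped : DE3 (n + 2) + DE3 (n - 1) = ped n.
  have [phi /card_fset_bijective] := ex_phi; rewrite /ped => ->.
  rewrite cardfsU (_ : (_ `&` _)%fset = fset0) ?cardfs0 ?subn0 //.
  (* A common element would have sum both [n + 2] and [n - 1]. *)
  apply/fsetP => s; rewrite in_fsetI !in_pi_DE3 !in_pi_ped in_fset0.
  by apply/negP; lia.
split=> //; split=> //; rewrite card_ped /ped.
have [psi] := fset_bijective _ _ _ _ _ _ (@split_parts_in n)
  (@merge_parts_in n) (@split_partsK n) (@merge_partsK n).
exact: card_fset_bijective.
Qed.
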